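(* Let $n\ge2$ and let $W=W^{\omega_1}_{\mathrm{pol}}$, regarded as a function on $S=\phi(A_c)$ with values in the self-adjoint $(n+1)\times(n+1)$ matrices. Then the commutant algebra $$A_W=\{Y\in\mathrm{End}(\mathbb{C}^{n+1})\mid YW(x)=W(x)Y\ \text{for all }x\in S\}$$ is trivial, i.e. it consists of multiples of the identity matrix. Moreover, the real vector space $$\mathcal{A}_W=\{Y\in\mathrm{End}(\mathbb{C}^{n+1})\mid YW(x)=W(x)Y^*\ \text{for all }x\in S\}$$ is $*$-invariant, i.e. $Y\in\mathcal{A}_W$ implies $Y^*\in\mathcal{A}_W$.
   Context: $G=\mathrm{SL}(n+1,\mathbb{C})\times\mathrm{SL}(n+1,\mathbb{C})$, $H$ is the diagonal subgroup, $A_c=\{(t,t^{-1})\mid t\text{ diagonal in }\mathrm{SU}(n+1)\}$. On $A_c$, $\phi=(\phi_1,\dots,\phi_n)$ with $\phi_i(t,t^{-1})=\binom{n+1}{i}^{-1}\sum_{j_1<\dots<j_i}t_{j_1}^2\cdots t_{j_i}^2$. $V=\mathbb{C}^{n+1}$ has standard orthonormal basis $e_1,\dots,e_{n+1}$. For $m=1,\dots,n+1$ the irreducible $G$-module $V_m=\bigwedge^mV\otimes\bigwedge^{n+2-m}V$ (first factor of $G$ acting on the first tensor factor, second on the second), with its standard $\mathrm{SU}(n+1)\times\mathrm{SU}(n+1)$-invariant inner product, contains $V$ exactly once on restriction to $H$; let $j_m:V\to V_m$ be an isometric $H$-equivariant embedding and $p_m=j_m^*$. For $a\in A_c$, $p_m\circ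 a\circ j_m$ is diagonal in the basis $(e_i)$; $\Phi^{\omega_1}_0(a)$ is the $(n+1)\times(n+1)$ matrix whose $(i,m)$ entry is the scalar by which $p_m\circ a\circ j_m$ acts on $e_i$. $W^{\omega_1}_{\mathrm{pol}}$ is the $\mathrm{End}(\mathbb{C}^{n+1})$-valued polynomial in $n$ variables determined by $W^{\omega_1}_{\mathrm{pol}}(\phi(a))=\Phi^{\omega_1}_0(a)^*\,\Phi^{\omega_1}_0(a)$ for $a\in A_c$. *)

(* Defs.v *)
From HB Require Import structures.
From mathcomp Require Export all_boot all_order all_fingroup all_algebra.
From mathcomp Require Export complex classical_sets reals.
From mathcomp Require Export mpoly.

Set Implicit Arguments.
Unset Strict Implicit.
Unset Printing Implicit Defensive.

Import Order.TTheory GRing.Theory Num.Theory.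

Local Open Scope classical_set_scope.
Local Open Scope sesquilinear_scope.
Local Open Scope ring_scope.

Definition tidx (N p q : nat) : finType :=
  ({ffun 'I_p -> 'I_N} * {ffun 'I_q -> 'I_N})%type.

Section ExteriorTensor.
Variable C : numClosedFieldType.

(* V^{(x)p} (x) V^{(x)q} for V = C^N, in coordinates: x (u, w) is the
   coefficient of e_{u 0} (x) ... (x) e_{u (p-1)} (x) e_{w 0} (x) ... *)
Definition tens (N p q : nat) := {ffun tidx N p q -> C^o}.

(* The subspace /\^p V (x) /\^q V of tensors antisymmetric in the first p
   slots and in the last q slots; v_1 /\ ... /\ v_p is the tensor
   \sum_s (-1)^s v_{s 1} (x) ... (x) v_{s p}. *)
Definition ext_tens (N p q : nat) : set (tens N p q) :=
  [set x : tens N p q | forall (s : 'S_p) (t : 'S_q)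
      (u : {ffun 'I_p -> 'I_N}) (w : {ffun 'I_q -> 'I_N}),
    x ([ffun k => u (s k)], [ffun k => w (t k)]) =
    (-1) ^+ s * (-1) ^+ t * x (u, w)].

(* On ext_tens the factor (p! q!)^-1 makes the products
   (e_{i_1} /\ ... /\ e_{i_p}) (x) (e_{j_1} /\ ... /\ e_{j_q}) orthonormal. *)
Definition tdot (N p q : nat) (x y : tens N p q) : C :=
  (p`! * q`!)%:R^-1 * \sum_(k : tidx N p q) x k * (y k)^*.

Definition vdot (N : nat) (v w : 'cV[C]_N) : C := \sum_i v i 0 * (w i 0)^*.

Definition evec (N : nat) (i : 'I_N) : 'cV[C]_N := delta_mx i 0.

Definition tact (N p q : nat) (g : 'M[C]_N * 'M[C]_N) (x : tens N p q) :
    tens N p q :=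
  [ffun k : tidx N p q => \sum_(l : tidx N p q) (\prod_i g.1 (k.1 i) (l.1 i)) *
                    (\prod_i g.2 (k.2 i) (l.2 i)) * x l].

Definition SL (N : nat) : set 'M[C]_N := [set h | \det h = 1].

Definition H_equivariant (N p q : nat) (j : 'cV[C]_N -> tens N p q) :=
  forall h, SL h -> forall v, j (h *m v) = tact (h, h) (j v).

Definition isometric (N p q : nat) (j : 'cV[C]_N -> tens N p q) :=
  forall v w, tdot (j v) (j w) = vdot v w.

Definition adjoint (N p q : nat) (j : 'cV[C]_N -> tens N p q)
    (x : tens N p q) : 'cV[C]_N :=
  \col_i tdot x (j (evec i)).

Lemma adjointP (N p q : nat) (j : {linear 'cV[C]_N -> tens N p q}) x v :
  vdot (adjoint j x) v = tdot x (j v).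
Proof.
have {2}-> : v = \sum_i v i 0 *: evec i.
  apply/colP=> k; rewrite summxE (bigD1 k) //= big1 => [|i /negPf ne].
    by rewrite !mxE !eqxx mulr1 addr0.
  by rewrite !mxE eq_sym ne mulr0.
rewrite linear_sum /vdot /tdot mulr_sumr.
under [RHS]eq_bigr => k _.
  rewrite sum_ffunE rmorph_sum !mulr_sumr.
  over.
rewrite exchange_big /=; apply: eq_bigr => i _.
rewrite mxE /tdot mulrAC mulr_sumr; apply: eq_bigr => k _.
have -> : j (v i 0 *: evec i) k = v i 0 * j (evec i) k :> C.
  by rewrite linearZ ffunE.
rewrite [(_ * _)^*]rmorphM -[LHS]mulrA; congr (_ * _).
by rewrite mulrCA.
Qed.

End ExteriorTensor.

Section Spherical.
Variable C : numClosedFieldType.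
Variable n : nat.

(* m : 'I_n.+1 stands for the index m.+1 in 1, ..., n+1; thus the ambient
   tensor space of V_{m+1} = /\^(m+1) V (x) /\^(n+2-(m+1)) V. *)
Definition Vamb (m : 'I_n.+1) := tens C n.+1 m.+1 (n.+2 - m.+1).

Definition Vm (m : 'I_n.+1) : set (Vamb m) :=
  @ext_tens C n.+1 m.+1 (n.+2 - m.+1).

Definition isometric_embedding (m : 'I_n.+1)
    (j : {linear 'cV[C]_n.+1 -> Vamb m}) : Prop :=
  [/\ forall v, Vm (j v), H_equivariant j & isometric j].

Definition Ac : set ('M[C]_n.+1 * 'M[C]_n.+1) :=
  [set a | exists t : 'M[C]_n.+1,
    [/\ is_diag_mx t, t \is unitarymx, \det t = 1 & a = (t, invmx t)]].

(* The coordinate i : 'I_n is phi_{i+1}. *)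
Definition phi (a : 'M[C]_n.+1 * 'M[C]_n.+1) : 'I_n -> C := fun i =>
  'C(n.+1, i.+1)%:R^-1 *
  \sum_(J : {set 'I_n.+1} | #|J| == i.+1) \prod_(k in J) a.1 k k ^+ 2.

Definition phi_Ac : set ('I_n -> C) := phi @` Ac.

(* p_m \o a \o j_m is diagonal in the basis evec, so that its scalar on
   evec i is the i-th diagonal coefficient. *)
Definition Phi0 (j : forall m : 'I_n.+1, {linear 'cV[C]_n.+1 -> Vamb m})
    (a : 'M[C]_n.+1 * 'M[C]_n.+1) : 'M[C]_n.+1 :=
  \matrix_(i, m) (adjoint (j m) (tact a (j m (evec C i)))) i 0.

Definition meval_mx (W : 'M[{mpoly C[n]}]_n.+1) (x : 'I_n -> C) :
    'M[C]_n.+1 :=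
  map_mx (meval x) W.

Definition is_Wpol (j : forall m : 'I_n.+1, {linear 'cV[C]_n.+1 -> Vamb m})
    (W : 'M[{mpoly C[n]}]_n.+1) : Prop :=
  forall a, Ac a -> meval_mx W (phi a) = (Phi0 j a)^t* *m Phi0 j a.

Definition commutant (W : ('I_n -> C) -> 'M[C]_n.+1) : set 'M[C]_n.+1 :=
  [set Y | forall x, phi_Ac x -> Y *m W x = W x *m Y].

Definition real_commutant (W : ('I_n -> C) -> 'M[C]_n.+1) : set 'M[C]_n.+1 :=
  [set Y | forall x, phi_Ac x -> Y *m W x = W x *m Y^t*].

End Spherical.

(* Main.v *)
(* Weight considerations show that the (i, m) entry of Phi_0(t, t^-1) is t_i^-1
   times a convex combination F_(i,m)(s) of monomials in s = t^2, so that W(x)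
   has (k, l) entry \sum_i F_(i,k)(s)^* F_(i,l)(s). Put N = n + 1 and let z be
   a primitive N-th root of unity.
   - At s = z^r (1, ..., 1) one gets the rank one matrix N (z^(r (l - k)))_(k,l);
     the discrete Fourier transform in r of these N matrices yields the powers
     of the cyclic shift. The zeroth power is the identity, so Y W = W Y^*
     forces Y = Y^*; the other ones force a matrix commuting with W to be
     circulant.
   - At s proportional to (1, z, ..., z^n), equivariance under the cyclic
     permutation makes W diagonal. Its zeroth entry is N and its k-th entry is
     less than N for 0 < k < n, by the strict triangle inequality. A circulant
     matrix commuting with such a diagonal matrix is scalar as soon as n >= 2. *)

Require Import Defs.
From mathcomp Require Import separable cyclic cyclotomic ring.

Set Implicit Arguments.
Unset Strict Implicit.
Unset Printing Implicit Defensive.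

Import Order.TTheory GRing.Theory Num.Theory.

Local Open Scope classical_set_scope.
Local Open Scope sesquilinear_scope.
Local Open Scope ring_scope.

(** * Roots of unity *)

Lemma prim_root_exists (C : numClosedFieldType) (m : nat) :
  (0 < m)%N -> exists z : C, m.-primitive_root z.
Proof.
move=> m_gt0; pose p : {poly C} := 'X^m - 1.
have [r Dp] := closed_field_poly_normal p.
rewrite (monicP _) ?monicXnsubC // scale1r in Dp.
have rm1: all m.-unity_root r by apply/allP=> z; rewrite -root_prod_XsubC -Dp.
have sz_r: (m < (size r).+1)%N.
  by rewrite -(size_prod_XsubC r id) -Dp size_XnsubC.
have [|z] := hasP (has_prim_root m_gt0 rm1 _ sz_r); last by exists z.
by rewrite -separable_prod_XsubC -Dp separable_Xn_sub_1 // pnatr_eq0 -lt0n.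
Qed.

Lemma prim_root_norm (C : numClosedFieldType) (m : nat) (z : C) :
  m.-primitive_root z -> `|z| = 1.
Proof.
move=> zP; have m_gt0 := prim_order_gt0 zP; apply/eqP.
by rewrite -(@pexpr_eq1 _ _ m) // -normrX (prim_expr_order zP) normr1.
Qed.

Lemma conjC_norm1 (C : numClosedFieldType) (z : C) : `|z| = 1 -> z^* = z^-1.
Proof. by move=> z1; rewrite invC_norm z1 expr1n invr1 mul1r. Qed.

(** The sum is geometric with ratio [y]. Multiplied by [y - 1] it gives [y ^+ m - 1 = 0], and
    [y = 1] forces [a = b] because both exponents are below [m]. *)
Lemma prim_root_orthogonality (F : fieldType) (m : nat) (z : F) (a b : 'I_m) :
  m.-primitive_root z ->
  \sum_(r < m) z ^+ (r * a) / z ^+ (r * b) = (m * (a == b))%:R.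
Proof.
move=> zP; have z0 : z != 0 by rewrite (prim_root_eq0 zP) -lt0n (prim_order_gt0 zP).
pose y := z ^+ a / z ^+ b.
rewrite (eq_bigr (fun r : 'I_m => y ^+ r)) => [|r _]; last first.
  by rewrite /y expr_div_n -!exprM ![(r * _)%N]mulnC.
have [ab|ne] := eqVneq a b.
  rewrite muln1 (_ : y = 1); last by rewrite /y ab divff ?expf_neq0.
  rewrite (eq_bigr (fun=> 1)) => [|r _]; last by rewrite expr1n.
  by rewrite sumr_const card_ord.
rewrite muln0; apply/eqP; have: (y - 1) * \sum_(r < m) y ^+ r == 0.
  rewrite -subrX1 /y expr_div_n -!exprM ![(_ * m)%N]mulnC !exprM.
  by rewrite (prim_expr_order zP) !expr1n divr1 subrr.
rewrite mulf_eq0 => /orP[|//].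
rewrite subr_eq0 => /eqP y1; case/eqP: ne; apply/val_inj/eqP.
have : z ^+ a == z ^+ b by rewrite -[_ ^+ a](divfK (expf_neq0 b z0)) -/y y1 mul1r.
by rewrite (eq_prim_root_expr zP) !modn_small ?ltn_ord.
Qed.

(** * Symmetries and support of an equivariant embedding *)

Section EquivariantEmbedding.
Variables (C : numClosedFieldType) (N p q : nat).
Variable j : {linear 'cV[C]_N -> tens C N p q}.
Hypothesis j_ext : forall v, ext_tens (j v).
Hypothesis j_equi : H_equivariant j.
Hypothesis j_iso : isometric j.

(** One family contains both the diagonal torus ([s = 1]) and the signed permutations, the two kinds
    of group elements that equivariance is tested on. *)
Definition monomial_mx (s : 'S_N) (a : 'I_N -> C) : 'M[C]_N :=
  \matrix_(r, c) (a r *+ (r == s c)).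

Definition perm_tidx (s : 'S_N) (l : tidx N p q) : tidx N p q :=
  ([ffun i => s (l.1 i)], [ffun i => s (l.2 i)]).

Lemma perm_tidx_bij s : bijective (perm_tidx s).
Proof.
exists (perm_tidx s^-1) => -[u w]; rewrite /perm_tidx /=;
 by congr pair; apply/ffunP=> i; rewrite !ffunE ?permK ?permKV.
Qed.

Lemma perm_tidx1 l : perm_tidx 1 l = l.
Proof. by case: l => u w; congr pair; apply/ffunP=> i; rewrite !ffunE perm1. Qed.

Lemma det_monomial_mx s a : \det (monomial_mx s a) = (\prod_i a i) * (-1) ^+ s.
Proof.
have -> : monomial_mx s a = diag_mx (\row_i a i) *m perm_mx s^-1.
  apply/matrixP=> r c; rewrite mul_diag_mx !mxE mulr_natr.
  by rewrite (canF_eq (permKV s)) eq_sym.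
rewrite det_mulmx det_diag det_perm odd_permV; congr (_ * _).
by apply: eq_bigr => i _; rewrite mxE.
Qed.

Lemma monomial_mx_evec s a i :
  monomial_mx s a *m evec C i = a (s i) *: evec C (s i).
Proof.
apply/colP=> r; rewrite !mxE (bigD1 i) //= big1 => [|k /negPf ne].
  by rewrite !mxE !eqxx andbT mulr1 addr0 mulr_natr; case: eqP => // ->.
by rewrite !mxE ne mulr0.
Qed.

Lemma prod_monomial_mx s a m (u u' : {ffun 'I_m -> 'I_N}) :
  \prod_i monomial_mx s a (s (u i)) (u' i) = (\prod_i a (s (u i))) *+ (u' == u).
Proof.
have [->|/eqP ne] := eqVneq u' u.
  by apply: eq_bigr => i _; rewrite mxE eqxx.
have [i neq|eq_u] := pickP [pred i | u' i != u i]; last first.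
  by case: ne; apply/ffunP => i; apply/eqP/negbFE/eq_u.
by rewrite (bigD1 i) //= mxE (inj_eq perm_inj) eq_sym (negPf neq) mulr0n mul0r.
Qed.

Lemma tact_monomial_mx s a b (x : tens C N p q) l :
  tact (monomial_mx s a, monomial_mx s b) x (perm_tidx s l) =
  (\prod_i a (s (l.1 i))) * (\prod_i b (s (l.2 i))) * x l.
Proof.
rewrite ffunE (bigD1 l) //= [X in _ + X]big1 => [|l' ne].
  rewrite addr0; congr (_ * _ * _); apply: eq_bigr => i _;
  by rewrite !ffunE mxE eqxx.
under [X in X * _ * _]eq_bigr => i _ do rewrite ffunE.
under [X in _ * X * _]eq_bigr => i _ do rewrite ffunE.
rewrite !prod_monomial_mx; case: l l' ne => [u w] [u' w'] /=.
by rewrite xpair_eqE negb_and => /orP[] /negPf->; rewrite mulr0n ?(mul0r, mulr0).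
Qed.

Local Notation x i := (j (evec C i)).

Lemma embedding_monomial (s : 'S_N) a i l : (\prod_i a i) * (-1) ^+ s = 1 ->
  a (s i) * x (s i) (perm_tidx s l) =
  (\prod_i a (s (l.1 i))) * (\prod_i a (s (l.2 i))) * x i l.
Proof.
move=> det1; rewrite -tact_monomial_mx -j_equi; last first.
  by rewrite /SL /= det_monomial_mx.
by rewrite monomial_mx_evec linearZ ffunE.
Qed.

(** This is the torus case [s = 1]: the support of [x i] lies in the weight space of [evec C i]. *)
Lemma embedding_weight (a : 'I_N -> C) i l : \prod_i a i = 1 -> x i l != 0 ->
  (\prod_i a (l.1 i)) * (\prod_i a (l.2 i)) = a i.
Proof.
move=> det1 x0; apply: (mulIf x0).
have := @embedding_monomial 1 a i l; rewrite perm_tidx1 perm1 odd_perm1 mulr1.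
by move=> /(_ det1)->; congr (_ * _ * _); apply: eq_bigr => k _; rewrite perm1.
Qed.

Lemma embedding_perm_norm (s : 'S_N) i l :
  `|x (s i) (perm_tidx s l)| = `|x i l|.
Proof.
(* The sign at [i] brings the determinant to 1; being unimodular, it disappears in norms. *)
pose a k : C := if k == i then (-1) ^+ s else 1.
have a1 k : `|a k| = 1 by rewrite /a; case: ifP; rewrite ?normr_sign ?normr1.
have p1 m (u : 'I_m -> 'I_N) : `|\prod_k a (u k)| = 1.
  by rewrite normr_prod big1.
have : (\prod_i a i) * (-1) ^+ s = 1.
  rewrite (bigD1 i) //= big1 => [|k /negPf ne]; last by rewrite /a ne.
  by rewrite mulr1 /a eqxx -expr2 sqrr_sign.
move/(@embedding_monomial s a i l)/(congr1 Num.norm).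
by rewrite !normrM a1 !p1 !mul1r.
Qed.

(** Exchanging two slots with equal entries fixes the tensor index but reverses the sign of the
    coefficient. *)
Lemma embedding_inj1 i l : x i l != 0 -> injective l.1.
Proof.
case: l => u w /= x0 k1 k2 eu; apply/eqP/negPn/negP => ne; case/eqP: x0.
have := j_ext (evec C i) (tperm k1 k2) 1%g u w.
rewrite odd_tperm ne odd_perm1 /= expr1 mulr1 mulN1r.
have -> : [ffun k => u (tperm k1 k2 k)] = u.
  by apply/ffunP => k; rewrite ffunE; case: tpermP => // ->.
have -> : [ffun k => w ((1 : 'S_q)%g k)] = w.
  by apply/ffunP => k; rewrite ffunE perm1.
by move/eqP; rewrite -addr_eq0 -mulr2n mulrn_eq0 => /eqP.
Qed.

Lemma embedding_inj2 i l : x i l != 0 -> injective l.2.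
Proof.
case: l => u w /= x0 k1 k2 eu; apply/eqP/negPn/negP => ne; case/eqP: x0.
have := j_ext (evec C i) 1%g (tperm k1 k2) u w.
rewrite odd_tperm ne odd_perm1 /= expr1 mul1r mulN1r.
have -> : [ffun k => w (tperm k1 k2 k)] = w.
  by apply/ffunP => k; rewrite ffunE; case: tpermP => // ->.
have -> : [ffun k => u ((1 : 'S_p)%g k)] = u.
  by apply/ffunP => k; rewrite ffunE perm1.
by move/eqP; rewrite -addr_eq0 -mulr2n mulrn_eq0 => /eqP.
Qed.

(* Otherwise, for b in the image of l.1, the weight of the element of the
   torus with entries 2 at i and 1/2 at b would be at most 1 instead of 2. *)
Lemma embedding_index1 i l : (0 < p)%N -> x i l != 0 -> exists k, l.1 k = i.
Proof.
move=> p_gt0 x0; have inj1 := embedding_inj1 x0; have inj2 := embedding_inj2 x0.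
case: (pickP [pred k | l.1 k == i]) => [k /eqP|noi]; first by exists k.
have {}noi k : (l.1 k == i) = false := noi k.
pose k0 := Ordinal p_gt0; pose b := l.1 k0; have neb : b == i = false := noi k0.
pose a k : C := if k == i then 2 else if k == b then 2^-1 else 1.
have det1 : \prod_k a k = 1.
  rewrite (bigD1 i) //= (bigD1 b) ?neb //= big1 => [|k /andP[/negPf ki /negPf kb]].
    by rewrite /a eqxx neb eqxx mulr1 divff ?pnatr_eq0.
  by rewrite /a ki kb.
have := embedding_weight det1 x0; rewrite (bigD1 k0) //= big1 => [|k kk0]; last first.
  by rewrite /a noi (inj_eq inj1) (negPf kk0).
rewrite {1 3}/a -/b neb !eqxx mulr1 => e.
have : \prod_k a (l.2 k) <= 2.
  have le1 k : l.2 k != i -> 0 <= a (l.2 k) <= 1.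
    rewrite /a => /negPf->; case: ifP => _; rewrite ?ler01 ?lexx //.
    by rewrite invr_ge0 ler0n invf_le1 ?ltr0n // ler1n.
  case: (pickP [pred k | l.2 k == i]) => [k /eqP lk|no2].
    rewrite (bigD1 k) //= lk {1}/a eqxx ler_piMr ?ler0n //.
    by apply: prodr_ile1 => k' nek; apply: le1; rewrite -lk (inj_eq inj2).
  apply: le_trans (_ : 1 <= 2); last by rewrite ler1n.
  by apply: prodr_ile1 => k _; apply: le1; rewrite [_ == _]no2.
move/(ler_wpM2l (_ : 0 <= 2^-1)); rewrite e mulVf ?pnatr_eq0 //.
by rewrite invr_ge0 ler0n => /(_ isT); rewrite lern1.
Qed.

(** * Spherical functions as convex combinations of monomials *)

Definition coef_weight i l : C := (p`! * q`!)%:R^-1 * `|x i l| ^+ 2.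

Lemma coef_weight_ge0 i l : 0 <= coef_weight i l.
Proof. by rewrite mulr_ge0 ?invr_ge0 ?ler0n ?exprn_ge0. Qed.

Lemma coef_weight_eq0 i l : (coef_weight i l == 0) = (x i l == 0).
Proof.
rewrite mulf_eq0 invr_eq0 pnatr_eq0 muln_eq0 expf_eq0 normr_eq0 /=.
by rewrite !eqn0Ngt !fact_gt0.
Qed.

Lemma sum_coef_weight i : \sum_l coef_weight i l = 1.
Proof.
have := j_iso (evec C i) (evec C i).
have -> : vdot (evec C i) (evec C i) = 1.
  rewrite /vdot (bigD1 i) //= big1 => [|k /negPf ne]; last by rewrite !mxE ne mul0r.
  by rewrite !mxE !eqxx mul1r rmorph1 addr0.
by rewrite /tdot mulr_sumr => <-; apply: eq_bigr => l _; rewrite /coef_weight normCK.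
Qed.

Lemma coef_weight_perm (s : 'S_N) i l :
  coef_weight (s i) (perm_tidx s l) = coef_weight i l.
Proof. by rewrite /coef_weight embedding_perm_norm. Qed.

(** For the embedding [j m] this is the function F_(i,m) of the overview. For fixed [i] the weights
    are nonnegative with sum 1. *)
Definition sphericalF (i : 'I_N) (s : 'I_N -> C) : C :=
  \sum_l coef_weight i l * \prod_k s (l.1 k).

Lemma sphericalF_const i (s : 'I_N -> C) c : (forall k, s k = c) ->
  sphericalF i s = c ^+ p.
Proof.
move=> sc; rewrite /sphericalF; under eq_bigr => l _.
  rewrite (eq_bigr (fun=> c)) // prodr_const card_ord; over.
by rewrite -mulr_suml sum_coef_weight mul1r.
Qed.

(** The weights are invariant under relabelling by [g], and each of the [p] factors of a monomial
    contributes one [c]. *)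
Lemma sphericalF_perm (g : 'S_N) i (s : 'I_N -> C) c :
  (forall k, s (g k) = c * s k) ->
  sphericalF (g i) s = c ^+ p * sphericalF i s.
Proof.
move=> sg; rewrite /sphericalF (reindex (perm_tidx g)) /=; last first.
  by apply: onW_bij; apply: perm_tidx_bij.
rewrite mulr_sumr; apply: eq_bigr => l _; rewrite coef_weight_perm mulrCA.
congr (_ * _); under eq_bigr => k _ do rewrite ffunE sg.
by rewrite big_split prodr_const card_ord.
Qed.

(** The only slot of the first factor must hold [i], so every monomial on the support is [s i]. *)
Lemma sphericalF1 i s : p = 1%N -> sphericalF i s = s i.
Proof.
move=> p1; rewrite -[RHS]mul1r -(sum_coef_weight i) mulr_suml.
apply: eq_bigr => l _; have [x0|x0] := eqVneq (x i l) 0.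
  by rewrite /coef_weight x0 normr0 expr0n /= !(mul0r, mulr0).
have [k lk] : exists k, l.1 k = i by apply: embedding_index1 x0; rewrite p1.
rewrite (eq_bigr (fun=> s i)) ?prodr_const ?card_ord ?p1 // => k' _.
have lt1 (h : 'I_p) : (h < 1)%N by rewrite -p1.
suff -> : k' = k by rewrite lk.
apply: val_inj; move: (lt1 k) (lt1 k'); rewrite !ltnS !leqn0 => /eqP kE /eqP kE'.
by rewrite /= kE kE'.
Qed.

(* The value is a convex combination of unimodular numbers, two of which are
   distinct: exchanging an index occurring in l.1 with one which does not
   moves the support and changes the product. *)
Lemma sphericalF_norm_lt1 i (s : 'I_N -> C) : (1 < p < N)%N ->
  injective s -> (forall k, `|s k| = 1) -> `|sphericalF i s| < 1.
Proof.
move=> /andP[p_gt1 ltpN] s_inj s1.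
have prod1 (l : tidx N p q) : `|\prod_k s (l.1 k)| = 1.
  by rewrite normr_prod big1.
have normF l : `|coef_weight i l * \prod_k s (l.1 k)| = coef_weight i l.
  by rewrite normrM prod1 mulr1 ger0_norm ?coef_weight_ge0.
have le1 : `|sphericalF i s| <= 1.
  rewrite -(sum_coef_weight i); apply: le_trans (ler_norm_sum _ _ _) _.
  by apply: ler_sum => l _; rewrite normF.
rewrite lt_neqAle le1 andbT; apply/eqP => eq1.
(* Equality in the triangle inequality gives all terms a common phase [t]. *)
have [t _ tP] : {t : C | `|t| == 1 & forall l, true ->
    coef_weight i l * \prod_k s (l.1 k) =
    `|coef_weight i l * \prod_k s (l.1 k)| * t}.
  apply: normC_sum_eq; rewrite [LHS]eq1.
  by under [RHS]eq_bigr => l _ do rewrite normF; rewrite sum_coef_weight.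
have {}tP l : x i l != 0 -> \prod_k s (l.1 k) = t.
  rewrite -coef_weight_eq0 => nz; apply: (mulfI nz).
  by rewrite tP // normF.
have [l xl] : exists l, x i l != 0.
  case: (pickP [pred l | x i l != 0]) => [l xl|no]; first by exists l.
  have := sum_coef_weight i; rewrite big1 => [/esym/eqP|l _].
    by rewrite oner_eq0.
  by apply/eqP; rewrite coef_weight_eq0; apply/negbFE/no.
have inj1 := embedding_inj1 xl.
have [ki lki] := embedding_index1 (ltnW p_gt1) xl.
(* A slot [ka] not holding [i] exists because [1 < p], an absent index [b] because [p < N]; hence
   exchanging [l.1 ka] and [b] fixes [i]. *)
have [ka neka] : exists ka, ka != ki.
  case: (pickP [pred k | k != ki]) => [k|no]; first by exists k.
  have : #|'I_p| = #|pred1 ki|.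
    by apply: eq_card => k; rewrite !inE; apply/esym/negbFE/no.
  by rewrite card_ord card1 => p1; rewrite p1 in p_gt1.
have [b nob] : exists b, b \notin codom l.1.
  case: (pickP [pred b | b \notin codom l.1]) => [b|no]; first by exists b.
  have : (#|'I_N| <= #|codom l.1|)%N.
    by apply/subset_leq_card/fintype.subsetP => b _; apply/negbFE/no.
  by rewrite card_codom // !card_ord leqNgt ltpN.
have nb k : l.1 k != b.
  by apply: contra nob => /eqP <-; apply: codom_f.
pose a := l.1 ka; pose g := tperm a b.
have gi : g i = i.
  by rewrite tpermD // -lki; [rewrite (inj_eq inj1) | rewrite eq_sym nb].
have : x i (perm_tidx g l) != 0.
  by rewrite -coef_weight_eq0 -{1}gi coef_weight_perm coef_weight_eq0.
move/tP; rewrite -(tP l xl) (bigD1 ka) //= [RHS](bigD1 ka) //= ffunE tpermL.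
rewrite (eq_bigr (fun k => s (l.1 k))) => [|k nek]; last first.
  by rewrite ffunE tpermD // eq_sym ?nb // (inj_eq inj1).
move/mulIf => e; have /s_inj/eqP : s b = s (l.1 ka).
  apply: e; apply/prodf_neq0 => k _; rewrite -normr_eq0 s1; exact: oner_neq0.
by rewrite eq_sym (negPf (nb ka)).
Qed.

(** Let A and B be the products of [d] over [l.1] and [l.2]. On the support A B = [d i], so the
    torus factor A / B equals A^2 / [d i]. *)
Lemma adjoint_tact_torus (d : 'I_N -> C) i : \prod_i d i = 1 ->
  (forall k, `|d k| = 1) ->
  adjoint j (tact (monomial_mx 1 d, monomial_mx 1 (fun k => (d k)^-1)) (x i))
    i 0 = (d i)^-1 * sphericalF i (fun k => d k ^+ 2).
Proof.
move=> det1 d1; rewrite mxE /tdot mulr_sumr /sphericalF mulr_sumr.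
have d0 k : d k != 0 by rewrite -normr_eq0 d1 oner_neq0.
apply: eq_bigr => l _; rewrite -[X in tact _ _ X]perm_tidx1 tact_monomial_mx.
have [x0|x0] := eqVneq (x i l) 0.
  by rewrite /coef_weight x0 normr0 expr0n /= !(mul0r, mulr0).
rewrite /coef_weight normCK prodrXl -(embedding_weight det1 x0).
under eq_bigr => k _ do rewrite perm1.
under [\prod_i (d _)^-1]eq_bigr => k _ do rewrite perm1.
rewrite prodfV.
set A := \prod_i d (l.1 i); set B := \prod_i d (l.2 i).
have A0 : A != 0 by apply/prodf_neq0.
have B0 : B != 0 by apply/prodf_neq0.
move: (p`! * q`!)%:R^-1 (x i l) ((x i l)^*) => c y z.
by field; rewrite A0 B0.
Qed.

End EquivariantEmbedding.

(** * Values of [W] at special points *)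

Section Points.
Variables (C : numClosedFieldType) (n : nat).
Variable j : forall m : 'I_n.+1, {linear 'cV[C]_n.+1 -> Vamb C m}.
Hypothesis hj : forall m, isometric_embedding (j m).
Variable W : 'M[{mpoly C[n]}]_n.+1.
Hypothesis hW : is_Wpol j W.

(** The prefactors [(d i)^-1] are unimodular and cancel in the product of the adjoint of [Phi0] with
    [Phi0]. *)
Lemma Wpol_torus (d : 'I_n.+1 -> C) : \prod_i d i = 1 ->
  (forall i, `|d i| = 1) ->
  exists2 x, phi_Ac x & forall k l, meval_mx W x k l =
    \sum_i (sphericalF (j k) i (fun a => d a ^+ 2))^* *
            sphericalF (j l) i (fun a => d a ^+ 2).
Proof.
move=> det1 d1; pose t := monomial_mx 1 d.
have d0 k : d k != 0 by rewrite -normr_eq0 d1 oner_neq0.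
have tE : t = diag_mx (\row_i d i).
  by apply/matrixP=> r c; rewrite !mxE perm1; case: eqP => // ->.
have tt1 : t *m monomial_mx 1 (fun k => (d k)^-1) = 1%:M.
  apply/matrixP=> r c; rewrite tE mul_diag_mx !mxE perm1.
  by case: eqP => [->|_]; rewrite ?mulr0n ?mulr0 ?mulfV.
have t_unitary : t \is unitarymx.
  apply/unitarymxP; rewrite -tt1; congr (_ *m _).
  apply/matrixP=> r c; rewrite !mxE !perm1 eq_sym.
  by case: eqP => [->|_]; rewrite ?mulr0n ?rmorph0 ?mulr1n ?conjC_norm1.
have t_unit : t \in unitmx by case/mulmx1_unit: tt1.
have inv_t : invmx t = monomial_mx 1 (fun k => (d k)^-1).
  by rewrite -[RHS](mulKmx t_unit) tt1 mulmx1.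
have Ac_t : Ac (t, invmx t).
  exists t; split=> //; first by rewrite tE diag_mx_is_diag.
  by rewrite det_monomial_mx det1 odd_perm1 mulr1.
exists (phi (t, invmx t)); first by exists (t, invmx t).
move=> k l; rewrite (hW Ac_t) mxE; apply: eq_bigr => i _.
have PhiE m : Phi0 j (t, invmx t) i m =
    (d i)^-1 * sphericalF (j m) i (fun a => d a ^+ 2).
  by case: (hj m) => jE jH jI; rewrite mxE inv_t adjoint_tact_torus.
rewrite 2!mxE !PhiE rmorphM /= conjC_norm1 ?normfV ?d1 ?invr1 // invrK.
by rewrite mulrACA mulfV ?mul1r.
Qed.

Lemma Wpol_scalar (z : C) r : n.+1.-primitive_root z ->
  exists2 x, phi_Ac x & forall k l : 'I_n.+1,
    meval_mx W x k l = n.+1%:R * (z ^+ (r * l) / z ^+ (r * k)).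
Proof.
move=> zP; have z1 := prim_root_norm zP.
have z0 : z != 0 by rewrite (prim_root_eq0 zP).
pose e := sqrtC z; have e2 : e ^+ 2 = z by rewrite sqrtCK.
have e1 : `|e| = 1 by apply/eqP; rewrite -(@pexpr_eq1 _ _ 2) // -normrX e2 z1.
have e0 : e != 0 by rewrite -normr_eq0 e1 oner_neq0.
(* The scalar [e ^+ r] has determinant [e ^+ (r * n.+1)], whose square is 1. Dividing one entry by
   it makes the determinant 1 and leaves all squares equal to [z ^+ r]. *)
pose d (i : 'I_n.+1) := e ^+ r * (if i == 0 then (e ^+ (r * n.+1))^-1 else 1).
have [||x xS xE] := @Wpol_torus d.
- rewrite big_split prodr_const card_ord -exprM (bigD1 0) //= big1 => [|i /negPf->] //.
  by rewrite mulr1 divff ?expf_neq0.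
- move=> i; rewrite normrM normrX e1 expr1n mul1r.
  by case: ifP; rewrite ?normr1 // normfV normrX e1 expr1n invr1.
exists x => // k l; rewrite xE.
have d2 i : d i ^+ 2 = z ^+ r.
  rewrite exprMn exprAC e2; case: ifP => _; last by rewrite expr1n mulr1.
  rewrite exprVn exprAC e2 mulnC exprM (prim_expr_order zP) expr1n invr1.
  by rewrite mulr1.
have FE m i : sphericalF (j m) i (fun a => d a ^+ 2) = z ^+ r ^+ m.+1.
  by case: (hj m) => _ _ jI; apply: (sphericalF_const jI).
rewrite (eq_bigr (fun=> z ^+ (r * l) / z ^+ (r * k))) => [|i _].
  by rewrite sumr_const card_ord mulr_natl.
rewrite !FE rmorphXn /= conjC_norm1 ?normrX ?z1 ?expr1n // !exprS exprVn -!exprM.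
by rewrite mulrACA mulVf ?expf_neq0 // mul1r mulrC.
Qed.

Lemma Wpol_diag : exists2 x, phi_Ac x & exists D : 'I_n.+1 -> C,
  [/\ forall k l, meval_mx W x k l = D k *+ (k == l), D ord0 = n.+1%:R
    & forall k : 'I_n.+1, (0 < k < n)%N -> D k < n.+1%:R].
Proof.
(* With [z = t ^+ 4], the power [t ^+ 2] is a square root of [z], and [t ^+ n] normalizes the
   determinant, as the exponents [2 * i] sum to [n * n.+1]. *)
have [t tP] := prim_root_exists C (isT : (0 < 4 * n.+1)%N).
have t1 := prim_root_norm tP.
have t0 : t != 0 by rewrite (prim_root_eq0 tP).
have zP : n.+1.-primitive_root (t ^+ 4).
  by have := dvdn_prim_root tP (dvdn_mull 4 (dvdnn n.+1)); rewrite mulnK.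
set z := t ^+ 4 in zP.
have z1 : `|z| = 1 by rewrite normrX t1 expr1n.
have z0 : z != 0 by rewrite expf_neq0.
pose d (i : 'I_n.+1) := t ^+ (2 * i) / t ^+ n.
have [||x xS xE] := @Wpol_torus d.
- rewrite big_split prodr_const card_ord exprVn -exprM prodrXr /=.
  suff -> : (\sum_(i < n.+1) 2 * i)%N = (n * n.+1)%N by rewrite divff ?expf_neq0.
  elim: (n) => [|m IHm]; first by rewrite big_ord1.
  by rewrite big_ord_recr IHm /= -mulnDl addn2 mulnC.
- by move=> i; rewrite normrM normfV !normrX t1 !expr1n invr1 mulr1.
pose s (i : 'I_n.+1) := d i ^+ 2.
have s_def i : s i = z ^+ i / t ^+ (2 * n).
  rewrite /s exprMn exprVn -!exprM -mulnA [(_ * 2)%N]mulnC mulnA.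
  by rewrite [(n * 2)%N]mulnC.
have s_shift i : s (ordS i) = z * s i.
  by rewrite !s_def /= (prim_expr_mod zP) exprS mulrA.
have s_inj : injective s.
  move=> i i'; rewrite !s_def; move/mulIf => /(_ _)/eqP.
  rewrite (eq_prim_root_expr zP) !modn_small ?ltn_ord // => H.
  by apply/val_inj/eqP/H; rewrite invr_eq0 expf_neq0.
have s1 i : `|s i| = 1.
  by rewrite s_def normrM normfV !normrX t1 !expr1n invr1 mulr1.
(* The cyclic shift multiplies [s] by [z]; applying it [i] times carries index 0 to [i].
   Orthogonality then removes the off-diagonal entries of [W]. *)
have FE m (i : 'I_n.+1) :
    sphericalF (j m) i s = z ^+ (i * m.+1) * sphericalF (j m) ord0 s.
  case: (hj m) => jE jH jI; case: i => i ltin; elim: i ltin => [|i IHi] ltin.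
    by rewrite mul0n mul1r; congr sphericalF; apply: val_inj.
  have lt_i : (i < n.+1)%N by apply: ltnW.
  have gi : perm (@ordS_inj _) (Ordinal lt_i) = Ordinal ltin.
    by apply: val_inj; rewrite permE /= modn_small.
  rewrite -{1}gi (@sphericalF_perm _ _ _ _ _ jH _ _ _ z) => [|k]; last first.
    by rewrite permE s_shift.
  by rewrite IHi mulrA -exprD /= mulSn.
exists x => //; exists (fun k => n.+1%:R * `|sphericalF (j k) ord0 s| ^+ 2).
split=> [k l||k k_bd].
- rewrite xE -/s.
  rewrite (eq_bigr (fun i : 'I_n.+1 => z ^+ (i * l) / z ^+ (i * k) *
      ((sphericalF (j k) ord0 s)^* * sphericalF (j l) ord0 s))) => [|i _].
    rewrite -mulr_suml (prim_root_orthogonality _ _ zP) natrM eq_sym.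
    by case: eqP => [->|_]; rewrite ?mulr1 ?mulr1n ?normCKC // mulr0 mul0r.
  rewrite -/(s) FE [sphericalF (j l) i s]FE rmorphM /= conjC_norm1; last first.
    by rewrite normrX z1 expr1n.
  rewrite mulrACA; congr (_ * _); rewrite !mulnS !exprD invfM mulrACA.
  by rewrite mulVf ?expf_neq0 // mul1r mulrC.
- case: (hj ord0) => jE jH jI.
  by rewrite (sphericalF1 jE jH jI) // s1 expr1n mulr1.
(* Here [p = k.+1], so [0 < k < n] is exactly the range [1 < p < n.+1] of the strict inequality. *)
- case: (hj k) => jE jH jI; rewrite gtr_pMr ?ltr0n // expr_lt1 //.
  apply: (sphericalF_norm_lt1 jE jH jI) => //.
Qed.

(* Addition in 'I_n.+1 is modulo n.+1. *)
Definition shift_mx (c : 'I_n.+1) : 'M[C]_n.+1 :=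
  \matrix_(k, l) (l == k + c)%:R.

(** Separate [Y] and [Z] cover both algebras: [Z = Y] for the commutant and [Z = Y^t*] for the real
    one. *)
Lemma intertwine_shift_mx (Y Z : 'M[C]_n.+1) c :
  (forall x, phi_Ac x -> Y *m meval_mx W x = meval_mx W x *m Z) ->
  Y *m shift_mx c = shift_mx c *m Z.
Proof.
move=> YZ; have [z zP] := prim_root_exists C (ltn0Sn n).
have z0 : z != 0 by rewrite (prim_root_eq0 zP).
pose M r : 'M[C]_n.+1 := \matrix_(k, l) (n.+1%:R * (z ^+ (r * l) / z ^+ (r * k))).
have YM r : Y *m M r = M r *m Z.
  have [x xS xE] := Wpol_scalar r zP; rewrite (_ : M r = meval_mx W x) ?YZ //.
  by apply/matrixP=> k l; rewrite xE mxE.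
(* Fourier inversion in [r] selects [l = k + c]. One factor [n.+1] comes from [W], the other from
   orthogonality. *)
have NM : \sum_(r < n.+1) (z ^+ (r * c))^-1 *: M r =
    (n.+1%:R * n.+1%:R) *: shift_mx c.
  apply/matrixP=> k l; rewrite summxE !mxE -mulrA -natrM.
  rewrite -(prim_root_orthogonality l (k + c) zP).
  rewrite mulr_sumr; apply: eq_bigr => r _; rewrite !mxE mulrCA; congr (_ * _).
  rewrite (_ : z ^+ (r * (k + c)%R) = z ^+ (r * k) * z ^+ (r * c)).
    by rewrite invfM mulrC mulrA.
  by rewrite -exprD -mulnDr ![(r * _)%N]mulnC exprM (prim_expr_mod zP) -exprM.
have N0 : n.+1%:R * n.+1%:R != 0 :> C by rewrite -natrM pnatr_eq0.
apply: (scalerI N0); rewrite scalemxAr scalemxAl -NM mulmx_sumr mulmx_suml.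
by apply: eq_bigr => r _; rewrite -scalemxAr -scalemxAl YM.
Qed.

End Points.

(** * The commutant and the real commutant *)

Theorem theorem6p20 (R : realType) (n : nat) (hn : (2 <= n)%N)
  (j : forall m : 'I_n.+1, {linear 'cV[R[i]]_n.+1 -> Vamb R[i] m})
  (hj : forall m : 'I_n.+1, isometric_embedding (j m))
  (W : 'M[{mpoly R[i][n]}]_n.+1) (hW : is_Wpol j W) :
  commutant (meval_mx W) = [set Y | exists c : R[i], Y = c%:M] /\
  (forall Y : 'M[R[i]]_n.+1,
     real_commutant (meval_mx W) Y -> real_commutant (meval_mx W) (Y^t*)).
Proof.
split; last first.
  move=> Y YW; have := intertwine_shift_mx hj hW 0 YW.
  have -> : shift_mx R[i] (0 : 'I_n.+1) = 1%:M.
    by apply/matrixP=> k l; rewrite !mxE addr0 eq_sym.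
  by rewrite mulmx1 mul1mx => <-.
apply/seteqP; split=> [Y YW|_ [c ->] x _]; last by rewrite scalar_mxC.
(* [Y] is circulant: compare the entries at [(a - b, b)] in the commutation with the shift by
   [b]. *)
have Yshift a b : Y a b = Y (a - b) 0.
  have := intertwine_shift_mx (Y := Y) (Z := Y) hj hW b YW.
  move=> /matrixP/(_ (a - b) b).
  rewrite !mxE (bigD1 0) //= big1 => [|k /negPf ne]; last first.
    by rewrite !mxE -[X in X == _]add0r (inj_eq (addIr _)) eq_sym ne mulr0.
  rewrite mxE add0r eqxx mulr1 addr0 => ->.
  rewrite (bigD1 a) //= big1 => [|k /negPf ne]; last first.
    by rewrite !mxE subrK ne mul0r.
  by rewrite !mxE subrK eqxx mul1r addr0.
have [x xS [D [WD D0 Dlt]]] := Wpol_diag hj hW.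
have Yeq0 k l : D k != D l -> Y k l = 0.
  move=> neD; have /matrixP/(_ k l) := YW x xS.
  rewrite !mxE (bigD1 l) //= big1 => [|i /negPf ne]; last first.
    by rewrite WD ne mulr0.
  rewrite (bigD1 k) //= big1 => [|i /negPf ne]; last first.
    by rewrite WD eq_sym ne mul0r.
  rewrite !WD !eqxx !addr0 !mulr1n mulrC => /eqP.
  by rewrite -subr_eq0 -mulrBl mulf_eq0 subr_eq0 eq_sym (negPf neD) => /eqP.
have col0 (k : 'I_n.+1) : k != 0 -> Y k 0 = 0.
  move=> k0; have k_gt0 : (0 < k)%N by rewrite lt0n.
  have [k_lt|k_ge] := ltnP k n.
    by apply: Yeq0; rewrite D0 lt_eqF // Dlt // k_gt0 k_lt.
  (* The remaining index is [k = n], which is -1 modulo [n.+1]. Circulance moves this entry to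
     [Y 0 o1], which vanishes because [0 < 1 < n]. *)
  pose o1 := Ordinal (leqW hn : (1 < n.+1)%N).
  have <- : 0 - o1 = k.
    apply/eqP; rewrite subr_eq; apply/eqP/val_inj => /=.
    have -> : k = n :> nat by apply/eqP; rewrite eqn_leq k_ge -ltnS ltn_ord.
    by rewrite addn1 modnn.
  by rewrite -Yshift; apply: Yeq0; rewrite D0 gt_eqF // Dlt.
exists (Y 0 0); apply/matrixP=> a b; rewrite [LHS]Yshift mxE.
have [->|ne] := eqVneq a b; first by rewrite subrr mulr1n.
by rewrite col0 ?subr_eq0.
Qed.
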